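(* Let $\mathcal H$ be a (possibly infinite-dimensional) separable Hilbert space and let $\rho$ be a probability distribution on $(X,Y)\in\mathcal H\times\mathbb R$. Let $H=\mathbb E[X\otimes X]$ be the covariance operator, with largest eigenvalue $\lambda_{\max}$. Assume the noiseless model: there is $\theta_*\in\mathcal H$ (in particular $\|\theta_*\|_{\mathcal H}<\infty$) with $\langle\theta_*,X\rangle=Y$ $\rho$-almost surely. Assume the fourth moment condition: there is a finite constant $R\ge 0$ with $\mathbb E[\|X\|^2\,X\otimes X]\preccurlyeq R\,H$. Let $(x_t,y_t)_{t\ge0}$ be i.i.d. samples from $\rho$ and run constant step-size SGD $\theta_0=0$, $\theta_{t+1}=\theta_t-\gamma(\langle\theta_t,x_t\rangle-y_t)x_t$. Then for every $T\ge2$, with the step size $\gamma=(4R\ln T)^{-1}$, $$\mathbb E\,\mathcal R(\theta_T)\le 3R\|\theta_*\|_{\mathcal H}^2\,\frac{\ln T}{T},$$ where $\mathcal R(\theta)=\tfrac12\mathbb E_\rho(\langle\theta,X\rangle-Y)^2$ and the outer expectation is over the samples used by SGD.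
   Context: $\preccurlyeq$ denotes the Loewner order on self-adjoint operators. $\mathcal R(\theta)=\frac12(\theta-\theta_* )^\top H(\theta-\theta_* )$ in the noiseless model. *)

(* Defs.v *)
From HB Require Import structures.
From mathcomp Require Import all_boot all_order all_algebra.
From mathcomp Require Import all_classical all_reals all_analysis.
Set Implicit Arguments. Unset Strict Implicit. Unset Printing Implicit Defensive.
Import Order.TTheory GRing.Theory Num.Theory.
Import numFieldNormedType.Exports.
Local Open Scope classical_set_scope.
Local Open Scope ring_scope.

(* [ip] is a real inner product on V whose induced norm is the norm of V.
   Together with completeness of V (V : completeNormedModType R) this makes
   (V, ip) a real Hilbert space. *)
Definition is_hilbert_ip (R : realType) (V : completeNormedModType R)
    (ip : V -> V -> R) : Prop :=
  [/\ (forall u v, ip u v = ip v u),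
      (forall (a : R) u v w, ip (a *: u + v) w = a * ip u w + ip v w),
      (forall v, 0 <= ip v v),
      (forall v, ip v v = 0 -> v = 0) &
      (forall v, `|v| = Num.sqrt (ip v v))].

Definition separable_space (R : realType) (V : completeNormedModType R) : Prop :=
  exists D : set V, countable D /\ closure D = setT.

Definition iid_seq d d' (Om : measurableType d) (W : measurableType d')
    (R : realType) (Q : probability W R) (P : probability Om R)
    (S : nat -> W -> Om) : Prop :=
  [/\ (forall t, measurable_fun setT (S t)),
      (forall t (A : set Om), measurable A -> Q (S t @^-1` A) = P A) &
      (forall (s : seq nat) (A : nat -> set Om), uniq s ->
          (forall i, measurable (A i)) ->
          Q (\big[setI/setT]_(i <- s) (S i @^-1` A i)) =
          (\prod_(i <- s) Q (S i @^-1` A i))%E)].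

(* Population risk R(theta) = 1/2 E_rho (<theta, X> - Y)^2, where
   rho is the law of (X, Y) under P. *)
Definition risk d (Om : measurableType d) (R : realType)
    (V : completeNormedModType R) (P : probability Om R)
    (ip : V -> V -> R) (X : Om -> V) (Y : Om -> R) (th : V) : \bar R :=
  ((2%:R)^-1)%:E * (\int[P]_w ((ip th (X w) - Y w) ^+ 2)%:E)%E.

Fixpoint sgd (Om : Type) (R : realType) (V : completeNormedModType R)
    (ip : V -> V -> R) (X : Om -> V) (Y : Om -> R) (gamma : R)
    (om : nat -> Om) (t : nat) : V :=
  match t with
  | 0 => 0
  | t'.+1 =>
      let th := sgd ip X Y gamma om t' in
      th - (gamma * (ip th (X (om t')) - Y (om t'))) *: X (om t')
  end.

(* Main.v *)
(* Write eta_t = theta_t - theta_*, x_t for the sample used at step t,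
   f_t = E <x_t, eta_t>^2 (twice the expected risk) and c = gamma * r <= 2/5.
   For a comparison point b that depends only on x_0, ..., x_{t-1}, expanding
   |eta_{t+1} - b|^2 and polarizing <x_t, eta_t> <x_t, eta_t - b> gives
     E|eta_{t+1} - b|^2 + gamma f_t
       <= E|eta_t - b|^2 + gamma E<x_t, b>^2 + gamma^2 r f_t.
   With b = eta_s, summed over s <= t <= T, this bounds the mean of
   f_s, ..., f_T by f_s / (1 - c); hence the suffix means S_k of
   f_{T-k}, ..., f_T satisfy S_{k-1} <= (1 + c/k) S_k, and
   f_T = S_0 <= exp (c (1 + ln T)) S_T.  With b = 0 (where the polarized term
   is again gamma f_t) it bounds S_T by
   |theta_*|^2 / (gamma (2 - c) (T + 1)). *)
Require Import Defs.
From HB Require Import structures.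
From mathcomp Require Import all_boot all_order all_algebra.
From mathcomp Require Import all_classical all_reals all_analysis.
From mathcomp Require Import measurable_realfun ring lra.
Import Order.TTheory GRing.Theory Num.Theory.
Import numFieldNormedType.Exports.
Local Open Scope classical_set_scope.
Local Open Scope ring_scope.

(** * Inner product identities and weakly measurable maps into a separable Hilbert space *)

Section InnerProduct.
Set Implicit Arguments.
Unset Strict Implicit.
Context (R : realType) (V : completeNormedModType R) (ip : V -> V -> R).
Hypothesis hip : is_hilbert_ip ip.

Lemma ipC u v : ip u v = ip v u.
Proof. by case: hip. Qed.

Lemma ipDl u v w : ip (u + v) w = ip u w + ip v w.
Proof. by case: hip => _ /(_ 1 u v w); rewrite scale1r mul1r. Qed.

Lemma ip0l w : ip 0 w = 0.
Proof. by have := ipDl 0 0 w; rewrite addr0; lra. Qed.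

Lemma ipZl a u w : ip (a *: u) w = a * ip u w.
Proof. by case: hip => _ /(_ a u 0 w); rewrite addr0 ip0l addr0. Qed.

Lemma ipNl u w : ip (- u) w = - ip u w.
Proof. by rewrite -scaleN1r ipZl mulN1r. Qed.

Lemma ipBl u v w : ip (u - v) w = ip u w - ip v w.
Proof. by rewrite ipDl ipNl. Qed.

Lemma ipBr u v w : ip w (u - v) = ip w u - ip w v.
Proof. by rewrite !(ipC w) ipBl. Qed.

Lemma ipZr a u w : ip w (a *: u) = a * ip w u.
Proof. by rewrite !(ipC w) ipZl. Qed.

Lemma normV2 v : `|v| ^+ 2 = ip v v.
Proof. by case: hip => _ _ h0 _ ->; rewrite sqr_sqrtr. Qed.

Lemma normVB2 u v : `|u - v| ^+ 2 = `|u| ^+ 2 - 2 * ip u v + `|v| ^+ 2.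
Proof. by rewrite !normV2 ipBl !ipBr (ipC v u); ring. Qed.

(** Cauchy-Schwarz: the residual of [u] after projection onto the line of [v] has nonnegative
    squared norm. *)
Lemma ip_sqr_le u v : ip u v ^+ 2 <= `|u| ^+ 2 * `|v| ^+ 2.
Proof.
have [->|v0] := eqVneq v 0.
  by rewrite ipC ip0l expr0n mulr_ge0// sqr_ge0.
have nv : 0 < `|v| ^+ 2 by rewrite exprn_gt0// normr_gt0.
have := sqr_ge0 `|u - (ip u v / `|v| ^+ 2) *: v|.
rewrite normVB2 ipZr normrZ exprMn real_normK ?num_real//.
move: (ip u v) (`|v| ^+ 2) (`|u| ^+ 2) nv => p q s q0 h.
have -> : p ^+ 2 = s * q - q * (s - 2 * (p / q * p) + (p / q) ^+ 2 * q).
  by field; rewrite gt_eqF.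
by rewrite gerBl; apply: mulr_ge0 => //; exact: ltW.
Qed.

(** The cross term is polarized by [2p(p - q) = p^2 + (p - q)^2 - q^2] with [p = ip a x] and
    [q = ip b x]. Both sides are sums of nonnegative terms, so the identity can be integrated
    without assuming finiteness. *)
Lemma ip_sgd_step a b x g :
  `|a - (g * ip a x) *: x - b| ^+ 2 + (g * ip a x ^+ 2 + g * ip (a - b) x ^+ 2)
  = `|a - b| ^+ 2 + (g * ip b x ^+ 2 + g ^+ 2 * (`|x| ^+ 2 * ip a x ^+ 2)).
Proof.
rewrite addrAC normVB2 normrZ exprMn real_normK ?num_real// ipZr ipBl.
by ring.
Qed.

(** Measurability is tested on scalar products, so [V] carries no sigma-algebra; only real-valued
    functions are ever integrated. *)
Definition weakly_measurable d (T : measurableType d) (F : T -> V) : Prop :=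
  forall u, measurable_fun setT (fun w => ip u (F w)).

Hypothesis hsep : separable_space V.

Lemma dense_seq : exists D : nat -> V,
  forall v e, 0 < e -> exists n, `|v - D n| < e.
Proof.
case: hsep => D [cD clD].
have [x0 Dx0] : D !=set0.
  have : closure D 0 by rewrite clD.
  by move=> /(_ setT filterT)[x [Dx _]]; exists x.
have /countable_injP[f inj] := cD.
(* A left inverse of the injection of [D] into the naturals, with default value [x0] off its
   range. *)
pose g n := if pselect (exists2 x, D x & f x = n) is left h then
   projT1 (cid2 h) else x0.
exists g => v e e0.
have : closure D v by rewrite clD.
move=> /(_ (ball v e) (nbhsx_ballx _ _ e0))[x [Dx]].
rewrite -ball_normE /= => vx; exists (f x).
rewrite /g; case: pselect => [h|[]]; last by exists x.
by case: cid2 => y Dy /= /inj -> //; rewrite inE.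
Qed.

(** The squared norm is the supremum of [2 <D n, F> - |D n|^2] over a dense sequence: each gap is
    [|F - D n|^2], which is nonnegative and gets arbitrarily small. *)
Lemma weakly_measurable_norm2 d (T : measurableType d) (F : T -> V) :
  weakly_measurable F -> measurable_fun setT (fun w => `|F w| ^+ 2).
Proof.
move=> mF; have [D denseD] := dense_seq.
pose h n w := 2 * ip (D n) (F w) - `|D n| ^+ 2.
have hle n w : h n w <= `|F w| ^+ 2.
  have := sqr_ge0 `|F w - D n|; rewrite normVB2 (ipC (F w)) /h; lra.
have -> : (fun w => `|F w| ^+ 2) = (fun w => sups (h^~ w) 0%N).
  apply/funext => w; apply/eqP; rewrite eq_le; apply/andP; split.
  - apply/ler_addgt0Pr => e e0.
    have [n] := denseD (F w) (Num.sqrt e) ltac:(by rewrite sqrtr_gt0).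
    move=> hn; have : `|F w - D n| ^+ 2 <= e.
      by rewrite -(sqr_sqrtr (ltW e0)) lerXn2r ?nnegrE ?sqrtr_ge0//; exact: ltW.
    have : h n w <= sups (h^~ w) 0%N.
      apply: ub_le_sup; last by exists n.
      by exists (`|F w| ^+ 2) => _ [m _ <-].
    rewrite normVB2 (ipC (F w)) /h; lra.
  - apply: ge_sup; first by exists (h 0%N w); exists 0%N.
    by move=> _ [m _ <-].
apply: measurable_fun_sups.
- by move=> w _; exists (`|F w| ^+ 2) => _ [m _ <-].
- by move=> m; apply: measurable_funB => //; apply: measurable_funM.
Qed.

Lemma weakly_measurableB d (T : measurableType d) (F G : T -> V) :
  weakly_measurable F -> weakly_measurable G ->
  weakly_measurable (fun w => F w - G w).
Proof.
move=> mF mG u; under eq_fun do rewrite ipBr.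
exact: measurable_funB.
Qed.

Lemma weakly_measurableZ d (T : measurableType d) (a : T -> R) (F : T -> V) :
  measurable_fun setT a -> weakly_measurable F ->
  weakly_measurable (fun w => a w *: F w).
Proof.
move=> ma mF u; under eq_fun do rewrite ipZr.
exact: measurable_funM.
Qed.

Lemma weakly_measurable_cst d (T : measurableType d) (v : V) :
  weakly_measurable (fun _ : T => v).
Proof. by move=> u; exact: measurable_cst. Qed.

Lemma weakly_measurable_comp d1 d2 (T1 : measurableType d1)
    (T2 : measurableType d2) (F : T2 -> V) (s : T1 -> T2) :
  measurable_fun setT s -> weakly_measurable F -> weakly_measurable (F \o s).
Proof. by move=> ms mF u; exact: measurableT_comp (mF u) ms. Qed.

(** Polarization reduces the inner product of two random vectors to squared norms. *)
Lemma measurable_ip d (T : measurableType d) (F G : T -> V) :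
  weakly_measurable F -> weakly_measurable G ->
  measurable_fun setT (fun w => ip (F w) (G w)).
Proof.
move=> mF mG.
have -> : (fun w => ip (F w) (G w)) =
    (fun w => 2^-1 * (`|F w| ^+ 2 + `|G w| ^+ 2 - `|F w - G w| ^+ 2)).
  by apply/funext => w; rewrite normVB2; lra.
apply: measurable_funM => //; apply: measurable_funB.
  by apply: measurable_funD; exact: weakly_measurable_norm2.
by apply: weakly_measurable_norm2; exact: weakly_measurableB.
Qed.

End InnerProduct.

(** * Integrating out a variable independent of a sub-sigma-algebra *)

Section Independence.
Set Implicit Arguments.
Unset Strict Implicit.
Context (R : realType) (d d' : measure_display) (Om : measurableType d)
  (W : measurableType d') (P : probability Om R) (Q : probability W R).
Variables (G : set (set W)) (S : W -> Om).
Hypotheses (GI : setI_closed G) (GT : G setT)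
  (mG : G `<=` measurable) (mS : measurable_fun setT S)
  (indep : forall A B, G A -> measurable B ->
     Q (A `&` S @^-1` B) = (Q A * P B)%E).

Local Notation WG := (g_sigma_algebraType G).

Lemma measurable_g_sigma_algebra (A : set W) : <<s G >> A -> measurable A.
Proof. by apply: smallest_sub => //; exact: sigma_algebra_measurable. Qed.

Lemma measurable_fun_from_WG d2 (T2 : measurableType d2) (f : W -> T2) :
  measurable_fun setT (f : WG -> T2) -> measurable_fun setT f.
Proof. by move=> mf _ B mB; apply: measurable_g_sigma_algebra; exact: mf. Qed.

(** The identity seen as a map to the coarser sigma-algebra generated by [G]; pushing [Q] forward
    along it restricts [Q] to that sigma-algebra. *)
Let idG : W -> WG := id.

Let midG : measurable_fun setT idG.
Proof. by apply: measurable_fun_from_WG; exact: measurable_id. Qed.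

Let idM : {mfun W >-> WG} :=
  HB.pack idG (isMeasurableFun.Build _ _ _ _ _ midG).

(** For fixed [B] both sides are finite measures in [A] that agree on the pi-system [G], hence on
    the sigma-algebra it generates. *)
Lemma indep_g_sigma_algebra A B : <<s G >> A -> measurable B ->
  Q (A `&` S @^-1` B) = (Q A * P B)%E.
Proof.
move=> mA mB.
have mSB : measurable (S @^-1` B) by rewrite -[X in measurable X]setTI; exact: mS.
pose m1' : measure WG R := pushforward (mrestr Q mSB) idG.
pose m1 := m1' midG.
have PB0 : (0 <= fine (P B))%R by rewrite fine_ge0.
pose m2 : measure WG R := mscale (NngNum PB0) (distribution Q idM).
have PBE : ((fine (P B))%:E = P B)%E by rewrite fineK// fin_num_measure.
have -> : Q (A `&` S @^-1` B) = m1 A by [].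
have -> : (Q A * P B)%E = m2 A.
  by rewrite -PBE muleC.
apply: (@measure_unique _ R WG G (fun=> setT)) => //.
- by rewrite bigcup_const.
- move=> C GC; transitivity (Q C * P B)%E; first exact: indep.
  by rewrite -PBE muleC.
- move=> _; change (Q (setT `&` S @^-1` B) < +oo)%E.
  by rewrite setTI ltey_eq fin_num_measure.
Qed.

(** By independence the joint law of the identity and [S] is a product measure, and Tonelli
    applies. *)
Lemma indep_integral (g : WG * Om -> \bar R) :
  measurable_fun setT g -> (forall z, 0 <= g z)%E ->
  (\int[Q]_w g (w, S w) = \int[Q]_w \int[P]_o g (w, o))%E.
Proof.
move=> mg g0.
pose QG := distribution Q idM.
pose J (w : W) : WG * Om := (w, S w).
have mJ : measurable_fun setT J by exact: (measurable_fun_pair midG mS).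
pose JM : {mfun W >-> (WG * Om)%type} :=
  HB.pack J (isMeasurableFun.Build _ _ _ _ _ mJ).
transitivity (\int[distribution Q JM]_z g z)%E.
  by rewrite ge0_integral_distribution.
transitivity (\int[QG \x P]_z g z)%E.
  apply: eq_measure_integral => A mA _; apply/esym.
  apply: product_measure_unique mA => B C mB mC.
  exact: indep_g_sigma_algebra.
rewrite fubini_tonelli1// ge0_integral_distribution//.
  exact: measurable_fun_fubini_tonelli_F.
by move=> w; exact: integral_ge0.
Qed.

Lemma measurable_indep_integral (g : WG * Om -> \bar R) :
  measurable_fun setT g -> (forall z, 0 <= g z)%E ->
  measurable_fun setT (fun w : W => \int[P]_o g (w, o))%E.
Proof.
move=> mg g0.
have h := measurable_fun_fubini_tonelli_F (m2 := P) g mg g0.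
by move=> _ B mB; apply: measurable_g_sigma_algebra; exact: h.
Qed.

End Independence.

(** * Real inequalities: from suffix means to the last term, and numerical constants *)

Section LastIterate.
Set Implicit Arguments.
Unset Strict Implicit.
Variable R : realType.

Lemma inv_succ_le_ln (n : nat) : (0 < n)%N ->
  n.+1%:R^-1 <= ln n.+1%:R - ln n%:R :> R.
Proof.
move=> n0; have n0R : (0 : R) < n%:R by rewrite ltr0n.
have n1R : (0 : R) < n.+1%:R by rewrite ltr0n.
have : ln (1 + - n.+1%:R^-1 : R) <= - n.+1%:R^-1.
  by apply: le_ln1Dx; rewrite ltrN2 invf_lt1// ltr1n.
have -> : 1 + - n.+1%:R^-1 = n%:R / n.+1%:R :> R.
  by apply: (mulIf (lt0r_neq0 n1R)); rewrite mulrDl divfK ?gt_eqF// mulNr mulVf ?gt_eqF//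
     mul1r -natr1 addrK.
rewrite ln_div ?posrE// => h.
by rewrite -lerN2 opprB.
Qed.

Lemma last_iterate_le_average (f : nat -> R) (c : R) (T : nat) : 0 <= c ->
  (forall t, 0 <= f t) ->
  (forall s, (s <= T)%N ->
     (1 - c) * (\sum_(s <= t < T.+1) f t) <= (T - s).+1%:R * f s) ->
  (0 < T)%N ->
  f T <= expR (c * (1 + ln T%:R)) * ((\sum_(0 <= t < T.+1) f t) / T.+1%:R).
Proof.
move=> c0 f0 hf T0.
(* The sum of the last [k + 1] terms, so that [A k / k.+1%:R] is a suffix mean. *)
pose A k := \sum_((T - k)%N <= t < T.+1) f t.
have A0 k : 0 <= A k by exact: sumr_ge0.
have step k : (k < T)%N -> A k / k.+1%:R <= (1 + c / k.+1%:R) * (A k.+1 / k.+2%:R).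
  move=> kT.
  have AS : A k.+1 = f (T - k.+1)%N + A k.
    rewrite /A big_ltn; last by rewrite ltnS leq_subr.
    by rewrite subnSK.
  have := hf (T - k.+1)%N (leq_subr _ _).
  rewrite subKn// -/(A k.+1) => h.
  (* The hypothesis at [s = T - k.+1], with [f s] rewritten as [A k.+1 - A k]. *)
  have {}h : k.+2%:R * A k <= (k.+1%:R + c) * A k.+1.
    have -> : (k.+1%:R + c) * A k.+1 = k.+2%:R * A k.+1 - (1 - c) * A k.+1.
      by rewrite -[k.+2%:R]natr1; ring.
    rewrite AS in h *; lra.
  have k1 : (0 : R) < k.+1%:R by rewrite ltr0n.
  have k2 : (0 : R) < k.+2%:R by rewrite ltr0n.
  have -> : (1 + c / k.+1%:R) * (A k.+1 / k.+2%:R) =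
     (k.+1%:R + c) * A k.+1 / k.+2%:R / k.+1%:R.
    by field; rewrite !gt_eqF.
  by rewrite ler_pM2r ?invr_gt0// ler_pdivlMr// mulrC.
(* The factor with [k = 0] costs [expR c], the 1 in [1 + ln]; the later factors [1 + c / k.+1%:R]
   telescope into the logarithm by [inv_succ_le_ln]. *)
have main k : (k < T)%N ->
    f T <= expR (c * (1 + ln k.+1%:R)) * (A k.+1 / k.+2%:R).
  elim: k => [_|k IH kT].
    have -> : f T = A 0%N / 1%:R by rewrite /A subn0 big_nat1 divr1.
    apply: le_trans (step _ T0) _; rewrite ler_wpM2r ?divr_ge0//.
    by rewrite ln1 addr0 mulr1 divr1 expR_ge1Dx.
  apply: le_trans (IH (ltnW kT)) _.
  have -> : c * (1 + ln k.+2%:R) =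
      c * (1 + ln k.+1%:R) + c * (ln k.+2%:R - ln k.+1%:R) by ring.
  rewrite expRD -mulrA ler_wpM2l ?expR_ge0//.
  apply: le_trans (step _ kT) _; rewrite ler_wpM2r ?divr_ge0//.
  apply: le_trans (expR_ge1Dx _) _; rewrite ler_expR ler_wpM2l//.
  exact: inv_succ_le_ln.
case: T T0 hf @A A0 step main => // T _ _ A _ _ /(_ T (ltnSn _)).
by rewrite /A subnn.
Qed.

(** [expR (5 / 8)] is the fifth power of [expR (1 / 8) <= 8 / 7], and [(8 / 7) ^+ 5 < 2]. *)
Lemma ln2_ge : 5 / 8 <= ln 2 :> R.
Proof.
rewrite -[leLHS]expRK ler_ln ?posrE ?expR_gt0//.
have h : expR (1 / 8) <= 8 / 7 :> R.
  have := expR_ge1Dx (- (1 / 8) : R); rewrite expRN => h.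
  have e0 := expR_gt0 (1 / 8 : R).
  have : expR (1 / 8) * (1 + - (1 / 8)) <= (1:R).
    by rewrite -[leRHS](mulfV (lt0r_neq0 e0)) ler_pM2l.
  lra.
have -> : 5 / 8 = (1 / 8) * 5%:R :> R by lra.
rewrite expRM_natr.
apply: (@le_trans _ _ ((8 / 7) ^+ 5)); last by lra.
by rewrite lerXn2r ?nnegrE ?expR_ge0//; lra.
Qed.

Lemma expR_le_inv (x : R) : x < 1 -> expR x <= (1 - x)^-1.
Proof.
move=> x1; rewrite -[leLHS]invrK -expRN lef_pV2 ?posrE ?expR_gt0 ?subr_gt0//.
exact: expR_ge1Dx.
Qed.

(* [c] stands for [gamma * r]. *)
Lemma sgd_constant (T : nat) (c := (4 * ln T%:R)^-1 : R) : (2 <= T)%N ->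
  [/\ 0 < ln T%:R :> R, 0 < c, c <= 2 / 5 &
  expR (c * (1 + ln T%:R)) <= 3 / 2 * (2 - c)].
Proof.
move=> T2.
have L : 5 / 8 <= ln T%:R :> R.
  by apply: le_trans ln2_ge _; rewrite ler_ln ?posrE ?ltr0n ?ler_nat// (leq_trans _ T2).
have L0 : 0 < ln T%:R :> R by lra.
have cL : c * ln T%:R = 1 / 4 by rewrite /c; field; rewrite gt_eqF.
have c0 : 0 < c by rewrite invr_gt0 mulr_gt0.
(* The bound 2/5 is [1 / (4 * (5 / 8))]. *)
have c1 : c <= 2 / 5.
  suff : c * (5 / 8) <= 1 / 4 by lra.
  by rewrite -cL ler_pM2l.
(* The exponent is [c + 1 / 4]. With [expR x <= (1 - x)^-1] for both summands it remains to see
   [8 / 9 <= (1 - c) * (2 - c)], which holds for [c <= 2 / 5]. *)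
split=> //; rewrite mulrDr mulr1 cL expRD.
have h1 : expR c <= (1 - c)^-1 by apply: expR_le_inv; lra.
have h2 : expR (1 / 4) <= (1 - 1 / 4)^-1 :> R by apply: expR_le_inv; lra.
apply: (@le_trans _ _ ((1 - c)^-1 * (1 - 1 / 4)^-1)).
  by apply: ler_pM => //; exact: expR_ge0.
rewrite -invfM -[leLHS]mul1r ler_pdivrMr; last by apply: mulr_gt0; lra.
nra.
Qed.

End LastIterate.

(** * The sigma-algebra of the past samples and its independence of the next one *)

Section IidPast.
Set Implicit Arguments.
Unset Strict Implicit.
Context (R : realType) (d d' : measure_display) (Om : measurableType d)
  (W : measurableType d') (P : probability Om R) (Q : probability W R).
Variable S : nat -> W -> Om.
Hypothesis iidS : iid_seq Q P S.

Lemma measurable_sample t : measurable_fun setT (S t).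
Proof. by case: iidS. Qed.

(** Cylinder events of the first [t] samples: a pi-system generating their sigma-algebra. *)
Definition past (t : nat) : set (set W) :=
  [set A | exists2 B : nat -> set Om, (forall i, measurable (B i)) &
     A = \big[setI/setT]_(i <- iota 0 t) (S i @^-1` B i)].

Lemma past_setI_closed t : setI_closed (past t).
Proof.
move=> _ _ [B mB ->] [C mC ->]; exists (fun i => B i `&` C i).
  by move=> i; exact: measurableI.
by rewrite -big_split/=; apply: eq_bigr => i _; rewrite preimage_setI.
Qed.

Lemma past_setT t : past t setT.
Proof. by exists (fun=> setT) => //; rewrite big1. Qed.

Lemma past_measurable t : past t `<=` measurable.
Proof.
move=> _ [B mB ->]; elim/big_ind : _ => //; first exact: measurableI.
by move=> i _; rewrite -[X in measurable X]setTI; exact: measurable_sample.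
Qed.

Lemma past_indep t A B : past t A -> measurable B ->
  Q (A `&` S t @^-1` B) = (Q A * P B)%E.
Proof.
case: iidS => _ QS prodS [C mC ->] mB.
(* [B] becomes the factor at index [t] of a longer cylinder, so the product formula applies to [t]
   and to [t + 1] samples. *)
pose C' i := if i == t then B else C i.
have mC' i : measurable (C' i) by rewrite /C'; case: ifP.
have CC' i : i \in iota 0 t -> C' i = C i.
  by rewrite mem_iota add0n /C' => /andP[_ it]; rewrite ltn_eqF.
have C't : C' t = B by rewrite /C' eqxx.
have iotaS : iota 0 t.+1 = iota 0 t ++ [:: t] by rewrite -(addn1 t) iotaD.
transitivity (Q (\big[setI/setT]_(i <- iota 0 t.+1) (S i @^-1` C' i))).
  rewrite iotaS big_cat/= big_seq1 C't; congr (Q (_ `&` _)).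
  by apply: eq_big_seq => i /CC' ->.
rewrite !prodS ?iota_uniq// iotaS big_cat/= big_seq1 C't QS//; congr (_ * _)%E.
by apply: eq_big_seq => i /CC' ->.
Qed.

Lemma measurable_sample_past t i : (i < t)%N ->
  measurable_fun setT (S i : g_sigma_algebraType (past t) -> Om).
Proof.
move=> it _ B mB; rewrite setTI; apply: sub_gen_smallest.
exists (fun j => if j == i then B else setT); first by move=> j; case: ifP.
rewrite (bigD1_seq i) ?mem_iota ?iota_uniq//= eqxx big1 ?setIT// => j ji.
by rewrite (negbTE ji).
Qed.

End IidPast.

(** * Energy inequalities for SGD with exact labels *)

Section NoiselessSgd.
Set Implicit Arguments.
Unset Strict Implicit.
Context (R : realType) (V : completeNormedModType R) (ip : V -> V -> R)
  (d d' : measure_display) (Om : measurableType d) (W : measurableType d')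
  (P : probability Om R) (Q : probability W R).
Variables (X : Om -> V) (g : R).
Hypotheses (hip : is_hilbert_ip ip) (hsep : separable_space V)
  (mX : weakly_measurable ip X).

(** The source [T0] is left free to serve both for [W] and for [W] with the sigma-algebra of the
    past, where only the samples before [t] are known to be measurable. *)
Lemma weakly_measurable_sgd (Y : Om -> R) d0 (T0 : measurableType d0)
    (S : nat -> T0 -> Om) (t : nat) : measurable_fun setT Y ->
  (forall i, (i < t)%N -> measurable_fun setT (S i)) ->
  weakly_measurable ip (fun w => sgd ip X Y g (S^~ w) t).
Proof.
move=> mY; elim: t => [|t IH] mS /=.
  exact: weakly_measurable_cst.
have mth := IH (fun i it => mS i (ltnW it)).
have mXt : weakly_measurable ip (X \o S t).
  by apply: weakly_measurable_comp => //; exact: mS.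
apply: (weakly_measurableB hip) => //; apply: (weakly_measurableZ hip) => //.
apply: measurable_funM => //; apply: measurable_funB.
  exact: (measurable_ip hip hsep).
by apply: measurableT_comp => //; exact: mS.
Qed.

Lemma measurable_risk (F : W -> V) : weakly_measurable ip F ->
  measurable_fun setT (fun w => \int[P]_o ((ip (F w) (X o)) ^+ 2)%:E)%E.
Proof.
move=> mF; apply: (measurable_fun_fubini_tonelli_F (m2 := P)
  (fun z : W * Om => ((ip (F z.1) (X z.2)) ^+ 2)%:E)).
- apply/measurable_EFinP; apply: measurable_funX.
  exact: (measurable_ip hip hsep (weakly_measurable_comp measurable_fst mF)
    (weakly_measurable_comp measurable_snd mX)).
- by move=> z; rewrite lee_fin sqr_ge0.
Qed.

Variables (S : nat -> W -> Om) (theta_s : V) (r : R).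
Hypotheses (iX : P.-integrable setT (fun w => (`|X w| ^+ 2)%:E))
  (r0 : 0 <= r)
  (m4 : forall v, (\int[P]_w ((`|X w| ^+ 2 * (ip v (X w)) ^+ 2)%:E)
              <= r%:E * \int[P]_w (((ip v (X w)) ^+ 2)%:E))%E)
  (iidS : iid_seq Q P S) (g0 : 0 <= g).

(** The labels equal [ip theta_s (X o)] everywhere, not just almost surely, so the error recursion
    is exact. *)
Definition sgd_err (t : nat) (w : W) : V :=
  sgd ip X (fun o => ip theta_s (X o)) g (S^~ w) t - theta_s.

Local Notation eta := sgd_err.
Local Notation x t w := (X (S t w)).

Lemma sgd_errS t w :
  eta t.+1 w = eta t w - (g * ip (eta t w) (x t w)) *: x t w.
Proof. by rewrite /eta /= (ipBl hip) addrAC. Qed.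

Lemma weakly_measurable_err t : weakly_measurable ip (eta t).
Proof.
apply: (weakly_measurableB hip) => //.
apply: (weakly_measurable_sgd (mX theta_s)).
by move=> i _; exact: measurable_sample iidS i.
Qed.

Lemma weakly_measurable_err_past s t : (s <= t)%N ->
  weakly_measurable ip (eta s : g_sigma_algebraType (past S t) -> V).
Proof.
move=> st; apply: (weakly_measurableB hip) => //.
apply: (weakly_measurable_sgd (mX theta_s)).
by move=> i it; apply: measurable_sample_past; exact: leq_trans it st.
Qed.

Lemma weakly_measurable_sample t : weakly_measurable ip (fun w => x t w).
Proof. by apply: weakly_measurable_comp mX; exact: measurable_sample iidS t. Qed.

(** Plays the role of conditioning on the first [t] samples. *)
Lemma integral_fresh_sample t (h : g_sigma_algebraType (past S t) * Om -> \bar R) :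
  measurable_fun setT h -> (forall z, 0 <= h z)%E ->
  (\int[Q]_w h (w, S t w) = \int[Q]_w \int[P]_o h (w, o))%E.
Proof.
apply: indep_integral.
- exact: past_setI_closed.
- exact: past_setT.
- exact: past_measurable iidS t.
- exact: measurable_sample iidS t.
- exact: past_indep iidS t.
Qed.

Lemma measurable_integral_fresh_sample t
    (h : g_sigma_algebraType (past S t) * Om -> \bar R) :
  measurable_fun setT h -> (forall z, 0 <= h z)%E ->
  measurable_fun setT (fun w : W => \int[P]_o h (w, o))%E.
Proof. by apply: measurable_indep_integral; exact: past_measurable iidS t. Qed.

(** The quantity [f_t], written with a fresh [X] in place of the sample [x_t]. *)
Definition excess (t : nat) : \bar R :=
  (\int[Q]_w \int[P]_o ((ip (eta t w) (X o)) ^+ 2)%:E)%E.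

Lemma measurable_err_fresh s t : (s <= t)%N -> measurable_fun setT
  (fun z : g_sigma_algebraType (past S t) * Om => ip (eta s z.1) (X z.2)).
Proof.
move=> st; have me := weakly_measurable_err_past st.
have mf := @measurable_fst _ _ (g_sigma_algebraType (past S t)) Om.
have ms := @measurable_snd _ _ (g_sigma_algebraType (past S t)) Om.
exact: (measurable_ip hip hsep (weakly_measurable_comp mf me)
  (weakly_measurable_comp ms mX)).
Qed.

(** Every sample from time [s] on is independent of [eta s]; the case [s < t] serves the comparison
    point [eta s]. *)
Lemma excess_sample s t : (s <= t)%N ->
  (\int[Q]_w ((ip (eta s w) (x t w)) ^+ 2)%:E)%E = excess s.
Proof.
move=> st; rewrite /excess -(@integral_fresh_sample t
  (fun z => ((ip (eta s z.1) (X z.2)) ^+ 2)%:E))//.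
- apply/measurable_EFinP; apply: measurable_funX; exact: measurable_err_fresh.
- by move=> z; rewrite lee_fin sqr_ge0.
Qed.

Lemma excess_ge0 t : (0 <= excess t)%E.
Proof.
by apply: integral_ge0 => w _; apply: integral_ge0 => o _; rewrite lee_fin sqr_ge0.
Qed.

(** Conditionally on the past, [eta t] is a fixed vector to which [m4] applies. *)
Lemma fourth_moment_sample t :
  (\int[Q]_w (`|x t w| ^+ 2 * (ip (eta t w) (x t w)) ^+ 2)%:E
    <= r%:E * excess t)%E.
Proof.
have m2 : measurable_fun setT
    (fun z : g_sigma_algebraType (past S t) * Om =>
      (`|X z.2| ^+ 2 * (ip (eta t z.1) (X z.2)) ^+ 2)%:E).
  apply/measurable_EFinP; apply: measurable_funM.
    apply: (weakly_measurable_norm2 hip hsep).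
    by apply: (weakly_measurable_comp (F := X)).
  by apply: measurable_funX; exact: measurable_err_fresh.
have p2 (z : g_sigma_algebraType (past S t) * Om) :
    (0 <= (`|X z.2| ^+ 2 * (ip (eta t z.1) (X z.2)) ^+ 2)%:E)%E.
  by rewrite lee_fin mulr_ge0// sqr_ge0.
rewrite (@integral_fresh_sample t
  (fun z => (`|X z.2| ^+ 2 * (ip (eta t z.1) (X z.2)) ^+ 2)%:E))//.
rewrite -ge0_integralZl//.
- apply: ge0_le_integral => //.
  + by move=> w _; apply: integral_ge0 => o _; exact: (p2 (w, o)).
  + exact: (@measurable_integral_fresh_sample t _ m2 p2).
  + apply: emeasurable_funM => //; exact: measurable_risk (weakly_measurable_err t).
  + by move=> w _; exact: (m4 (eta t w)).
- exact: measurable_risk (weakly_measurable_err t).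
- by move=> w _; apply: integral_ge0 => o _; rewrite lee_fin sqr_ge0.
Qed.

Lemma ge0_integral_combination (A B C : W -> R) (a b : R) :
  measurable_fun setT A -> measurable_fun setT B -> measurable_fun setT C ->
  (forall w, 0 <= A w) -> (forall w, 0 <= B w) -> (forall w, 0 <= C w) ->
  0 <= a -> 0 <= b ->
  (\int[Q]_w (A w + (a * B w + b * C w))%:E =
   \int[Q]_w (A w)%:E + (a%:E * \int[Q]_w (B w)%:E +
                         b%:E * \int[Q]_w (C w)%:E))%E.
Proof.
move=> mA mB mC A0 B0 C0 a0 b0.
rewrite -!ge0_integralZl ?lee_fin//; last 4 first.
- exact/measurable_EFinP.
- by move=> w _; rewrite lee_fin.
- exact/measurable_EFinP.
- by move=> w _; rewrite lee_fin.
under [LHS]eq_integral do rewrite !EFinD.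
have mZ (c : R) (F : W -> R) : measurable_fun setT F ->
    measurable_fun setT (fun w : W => (c * F w)%:E).
  by move=> mF; apply/measurable_EFinP; exact: measurable_funM.
rewrite !ge0_integralD//.
- by move=> w _; rewrite lee_fin mulr_ge0.
- exact: mZ.
- by move=> w _; rewrite lee_fin mulr_ge0.
- exact: mZ.
- by move=> w _; rewrite lee_fin.
- exact/measurable_EFinP.
- by move=> w _; rewrite lee_fin addr_ge0// mulr_ge0.
- by apply/measurable_EFinP; apply: measurable_funD; exact: measurable_funM.
Qed.

(** [ip_sgd_step] integrated; the fourth moment condition is what turns the identity into an
    inequality. *)
Lemma sgd_step_integral t (b : W -> V) : weakly_measurable ip b ->
  (\int[Q]_w (`|eta t.+1 w - b w| ^+ 2)%:E +
    (g%:E * excess t + g%:E * \int[Q]_w (ip (eta t w - b w) (x t w) ^+ 2)%:E)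
   <= \int[Q]_w (`|eta t w - b w| ^+ 2)%:E +
    (g%:E * \int[Q]_w (ip (b w) (x t w) ^+ 2)%:E + (g ^+ 2 * r)%:E * excess t))%E.
Proof.
move=> mb.
have mN (F : W -> V) : weakly_measurable ip F ->
    measurable_fun setT (fun w => `|F w| ^+ 2).
  exact: (weakly_measurable_norm2 hip hsep).
have mx := weakly_measurable_sample t.
have mI (F : W -> V) : weakly_measurable ip F ->
    measurable_fun setT (fun w => ip (F w) (x t w) ^+ 2).
  by move=> mF; apply: measurable_funX; exact: (measurable_ip hip hsep).
have meb u := weakly_measurableB hip (weakly_measurable_err u) mb.
have me := weakly_measurable_err t.
have g20 : 0 <= g ^+ 2 by exact: sqr_ge0.
rewrite -(excess_sample (leqnn t)) -ge0_integral_combination//; last 5 first.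
- exact: mN (meb t.+1).
- exact: mI me.
- exact: mI (meb t).
- by move=> w; exact: sqr_ge0.
- by move=> w; exact: sqr_ge0.
under eq_integral do rewrite sgd_errS (ip_sgd_step hip).
rewrite ge0_integral_combination//; last 5 first.
- exact: mN (meb t).
- exact: mI mb.
- by apply: measurable_funM; [exact: mN mx | exact: mI me].
- by move=> w; exact: sqr_ge0.
- by move=> w; rewrite mulr_ge0// sqr_ge0.
rewrite (excess_sample (leqnn t)) leeD2l// leeD2l// (EFinM (g ^+ 2) r) -[leRHS]muleA.
by apply: lee_wpmul2l; [rewrite lee_fin | exact: fourth_moment_sample].
Qed.

(** Cauchy-Schwarz under both integrals; it serves to prove finiteness. *)
Lemma excess_le_norm t :
  (excess t <= (\int[P]_o (`|X o| ^+ 2)%:E) * \int[Q]_w (`|eta t w| ^+ 2)%:E)%E.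
Proof.
have mN : measurable_fun setT (fun w => (`|eta t w| ^+ 2)%:E).
  apply/measurable_EFinP.
  exact: (weakly_measurable_norm2 hip hsep (weakly_measurable_err t)).
have mNX : measurable_fun setT (fun o => (`|X o| ^+ 2)%:E).
  by apply/measurable_EFinP; exact: (weakly_measurable_norm2 hip hsep).
have p w : setT w -> (0 <= (`|eta t w| ^+ 2)%:E)%E by rewrite lee_fin sqr_ge0.
have pX o : setT o -> (0 <= (`|X o| ^+ 2)%:E)%E by rewrite lee_fin sqr_ge0.
have pI : (0 <= \int[P]_o (`|X o| ^+ 2)%:E)%E by exact: integral_ge0.
rewrite -ge0_integralZl//; apply: ge0_le_integral => //.
- by move=> w _; apply: integral_ge0 => o _; rewrite lee_fin sqr_ge0.
- exact: measurable_risk (weakly_measurable_err t).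
- exact: emeasurable_funM.
move=> w _; rewrite muleC -ge0_integralZl//.
apply: ge0_le_integral => //.
- by move=> o _; rewrite lee_fin sqr_ge0.
- by apply/measurable_EFinP; apply: measurable_funX; exact: mX.
- exact: emeasurable_funM.
- by move=> o _; rewrite -EFinM lee_fin (ip_sqr_le hip).
Qed.

Lemma sgd_descent t :
  (\int[Q]_w (`|eta t.+1 w| ^+ 2)%:E + (g%:E * excess t + g%:E * excess t)
   <= \int[Q]_w (`|eta t w| ^+ 2)%:E + (g ^+ 2 * r)%:E * excess t)%E.
Proof.
have := @sgd_step_integral t (fun=> 0) (weakly_measurable_cst ip 0 (T := W)).
have n0 u : (\int[Q]_w (`|eta u w - 0| ^+ 2)%:E =
    \int[Q]_w (`|eta u w| ^+ 2)%:E)%E.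
  by under eq_integral do rewrite subr0.
have -> : (\int[Q]_w (ip (eta t w - 0) (x t w) ^+ 2)%:E = excess t)%E.
  by under eq_integral do rewrite subr0; exact: excess_sample.
have -> : (\int[Q]_w (ip 0 (x t w) ^+ 2)%:E = 0)%E.
  by apply: integral0_eq => w _; rewrite (ip0l hip) expr0n.
by rewrite !n0 mule0 add0e.
Qed.

(** Induction on [t]: a finite mean squared norm makes the excess finite by [excess_le_norm], and
    then [sgd_descent] bounds the next norm. This allows real arithmetic afterwards. *)
Lemma err_norm_excess_fin t :
  (\int[Q]_w (`|eta t w| ^+ 2)%:E)%E \is a fin_num /\ excess t \is a fin_num.
Proof.
have N0 s : (0 <= \int[Q]_w (`|eta s w| ^+ 2)%:E)%E.
  by apply: integral_ge0 => w _; rewrite lee_fin sqr_ge0.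
have eF s : (\int[Q]_w (`|eta s w| ^+ 2)%:E)%E \is a fin_num ->
    excess s \is a fin_num.
  move=> h; rewrite ge0_fin_numE ?excess_ge0//.
  apply: le_lt_trans (excess_le_norm s) _.
  by rewrite ltey_eq fin_numM//; exact: (integrable_fin_num _ iX).
suff h : (\int[Q]_w (`|eta t w| ^+ 2)%:E)%E \is a fin_num by split; last exact: eF.
elim: t => [|t IH].
  under eq_integral do rewrite /eta/=.
  by rewrite integral_cst// fin_numM// fin_num_measure.
have h := eF _ IH.
rewrite ge0_fin_numE//.
apply: (@le_lt_trans _ _
  (\int[Q]_w (`|eta t w| ^+ 2)%:E + (g ^+ 2 * r)%:E * excess t)%E); last first.
  by rewrite ltey_eq fin_numD IH fin_numM.
apply: le_trans (sgd_descent t).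
by rewrite leeDl// adde_ge0// mule_ge0 ?lee_fin ?excess_ge0.
Qed.

Let M t : R := fine (\int[Q]_w (`|eta t w| ^+ 2)%:E)%E.
Local Notation f t := (fine (excess t)).

Let ME t : (\int[Q]_w (`|eta t w| ^+ 2)%:E = (M t)%:E)%E.
Proof. by rewrite fineK//; have [] := err_norm_excess_fin t. Qed.

Let fE t : excess t = (f t)%:E.
Proof. by rewrite fineK//; have [] := err_norm_excess_fin t. Qed.

Lemma excess_sum_le n :
  g * (2 - g * r) * (\sum_(0 <= t < n) f t) <= `|theta_s| ^+ 2.
Proof.
suff : M n + g * (2 - g * r) * (\sum_(0 <= t < n) f t) <= `|theta_s| ^+ 2.
  apply: le_trans; rewrite lerDr -lee_fin -ME.
  by apply: integral_ge0 => w _; rewrite lee_fin sqr_ge0.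
elim: n => [|n IH].
  rewrite big_nil mulr0 addr0 -lee_fin -ME.
  under eq_integral do rewrite /eta/= sub0r normrN.
  rewrite integral_cst// -[leRHS]mule1 lee_wpmul2l ?lee_fin ?sqr_ge0//.
  exact: probability_le1.
have := sgd_descent n; rewrite !ME (fE n) -!EFinM -!EFinD lee_fin => h.
rewrite big_nat_recr//= mulrDr addrCA.
apply: le_trans IH; rewrite addrC; lra.
Qed.

Lemma excess_suffix_sum_le s n :
  g * (1 - g * r) * (\sum_(s <= t < s + n) f t) <= g * n%:R * f s.
Proof.
pose D t := (\int[Q]_w (`|eta t w - eta s w| ^+ 2)%:E)%E.
have D0 t : (0 <= D t)%E.
  by apply: integral_ge0 => w _; rewrite lee_fin sqr_ge0.
(* Comparison point [b = eta s]; the nonnegative term in [eta t - eta s] is dropped. *)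
have step t : (s <= t)%N ->
    (D t.+1 + (g * f t)%:E <= D t + (g * f s + g ^+ 2 * r * f t)%:E)%E.
  move=> st; have := sgd_step_integral t (weakly_measurable_err s).
  rewrite (excess_sample st) (fE t) (fE s) -/(D _) -/(D _) -!EFinM -EFinD; apply: le_trans.
  rewrite leeD2l// leeDl// mule_ge0 ?lee_fin//.
  by apply: integral_ge0 => w _; rewrite lee_fin sqr_ge0.
suff : (D (s + n)%N + (g * (1 - g * r) * (\sum_(s <= t < s + n) f t))%:E
    <= (g * n%:R * f s)%:E)%E.
  by move=> h; rewrite -lee_fin; apply: le_trans h; rewrite leeDr.
elim: n => [|n IH].
  rewrite addn0 big_geq// mulr0 adde0 mulr0 mul0r /D.
  by rewrite integral0_eq// => w _; rewrite subrr normr0 expr0n.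
(* Finiteness of [D] comes from the induction hypothesis, which bounds it by a real number. *)
have DF : D (s + n)%N \is a fin_num.
  rewrite ge0_fin_numE//; apply: (@le_lt_trans _ _
    (g * n%:R * f s - g * (1 - g * r) * (\sum_(s <= t < s + n) f t))%:E).
    by rewrite EFinB leeBrDr.
  exact: ltry.
have DSF : D (s + n).+1 \is a fin_num.
  rewrite ge0_fin_numE//; apply: (@le_lt_trans _ _
    (D (s + n)%N + (g * f s + g ^+ 2 * r * f (s + n)%N)%:E - (g * f (s + n)%N)%:E)%E).
    by rewrite leeBrDr// step// leq_addr.
  by rewrite -(fineK DF); exact: ltry.
move: IH (step (s + n)%N (leq_addr _ _)); rewrite addnS.
rewrite -(fineK DF) -(fineK DSF) -!EFinD !lee_fin => IH h.
rewrite big_nat_recr ?leq_addr//= -[n.+1%:R]natr1.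
move: h IH; set a := fine _; set b := fine _; lra.
Qed.

End NoiselessSgd.

(** * From almost surely noiseless labels to exact ones, and the case of a zero moment constant *)

Section LabelledSgd.
Set Implicit Arguments.
Unset Strict Implicit.
Context (R : realType) (V : completeNormedModType R) (ip : V -> V -> R)
  (d d' : measure_display) (Om : measurableType d) (W : measurableType d')
  (P : probability Om R) (Q : probability W R).
Variables (X : Om -> V) (Y : Om -> R) (theta_s : V).
Hypotheses (hip : is_hilbert_ip ip) (hsep : separable_space V)
  (mX : weakly_measurable ip X) (mY : measurable_fun setT Y)
  (noiseless : {ae P, forall w, ip theta_s (X w) = Y w}).

Lemma risk_noiseless th : risk P ip X Y th =
  (2^-1%:E * \int[P]_o ((ip (th - theta_s) (X o)) ^+ 2)%:E)%E.
Proof.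
rewrite /risk; congr (_ * _)%E; apply: ge0_ae_eq_integral => //.
- apply/measurable_EFinP; apply: measurable_funX.
  by apply: measurable_funB => //; exact: mX.
- by apply/measurable_EFinP; apply: measurable_funX; exact: mX.
- by move=> o _; rewrite lee_fin sqr_ge0.
- by move=> o _; rewrite lee_fin sqr_ge0.
by apply: filterS noiseless => o /= <- _; rewrite (ipBl hip).
Qed.

(** Each [S t] has law [P], so it pulls the null set of bad labels back to a null set; finitely many
    of these are met up to time [t]. *)
Lemma sgd_noiseless_ae (S : nat -> W -> Om) (g : R) t : iid_seq Q P S ->
  {ae Q, forall w, sgd ip X Y g (S^~ w) t - theta_s =
                   sgd_err ip X g S theta_s t w}.
Proof.
case=> mS QS _; rewrite /sgd_err; elim: t => [|t IH]; first exact: aeW.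
have : {ae Q, forall w, ip theta_s (X (S t w)) = Y (S t w)}.
  case: noiseless => N [mN PN0 subN]; exists (S t @^-1` N); split.
  - by rewrite -[X in measurable X]setTI; exact: mS.
  - by rewrite QS.
  - by move=> w /= h; apply: subN.
by apply: filterS2 IH => w /= /addIr -> ->.
Qed.

Lemma integral_risk_sgd (S : nat -> W -> Om) (g : R) t : iid_seq Q P S ->
  (\int[Q]_w risk P ip X Y (sgd ip X Y g (S^~ w) t) =
   2^-1%:E * excess ip P Q X g S theta_s t)%E.
Proof.
move=> iidS.
have S0 w : setT w -> (0 <= \int[P]_o (ip (sgd_err ip X g S theta_s t w) (X o) ^+ 2)%:E)%E.
  by move=> _; apply: integral_ge0 => o _; rewrite lee_fin sqr_ge0.
have mE := weakly_measurable_err g hip hsep mX theta_s iidS t.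
have mE' : weakly_measurable ip (fun w => sgd ip X Y g (S^~ w) t - theta_s).
  apply: (weakly_measurableB hip) => //.
  apply: (weakly_measurable_sgd _ hip hsep mX mY) => i _.
  exact: measurable_sample iidS i.
have mR := measurable_risk P hip hsep mX mE.
have mR' := measurable_risk P hip hsep mX mE'.
rewrite /excess -ge0_integralZl// ?lee_fin//.
apply: ge0_ae_eq_integral => //.
- under eq_fun do rewrite risk_noiseless.
  by apply: emeasurable_funM => //; exact: mR'.
- by apply: emeasurable_funM => //; exact: mR.
- move=> w _; rewrite risk_noiseless mule_ge0 ?lee_fin//.
  by apply: integral_ge0 => o _; rewrite lee_fin sqr_ge0.
- by move=> w _; rewrite mule_ge0 ?lee_fin ?S0.
by apply: filterS (sgd_noiseless_ae g t iidS) => w h _; rewrite risk_noiseless h.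
Qed.

(* With [r = 0] the step size is the junk value [0^-1 = 0], so SGD stays at 0;
   but then the fourth moment condition forces the signal to vanish. *)
Lemma fourth_moment0 v :
  (\int[P]_w ((`|X w| ^+ 2 * (ip v (X w)) ^+ 2)%:E) <= 0)%E ->
  (\int[P]_w (((ip v (X w)) ^+ 2)%:E) = 0)%E.
Proof.
move=> h.
have mI : measurable_fun setT (fun w => (ip v (X w) ^+ 2)%:E).
  by apply/measurable_EFinP; apply: measurable_funX; exact: mX.
pose h2 w := (`|X w| ^+ 2 * (ip v (X w)) ^+ 2)%:E.
have mh2 : measurable_fun setT h2.
  apply/measurable_EFinP; apply: measurable_funM.
    exact: (weakly_measurable_norm2 hip hsep).
  by apply: measurable_funX; exact: mX.
have h20 w : setT w -> (0 <= h2 w)%E by rewrite lee_fin mulr_ge0// sqr_ge0.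
have : ae_eq P setT h2 (cst 0%E).
  apply/(ae_eq_integral_abs _ measurableT mh2).
  apply/eqP; rewrite eq_le integral_ge0// andbT.
  by under eq_integral => w _ do rewrite gee0_abs ?h20//.
move=> h20ae; rewrite -(integral0 P setT); apply: ge0_ae_eq_integral => //.
  by move=> w _; rewrite lee_fin sqr_ge0.
(* Where the product vanishes, either [X w = 0] or [ip v (X w) = 0], and the inner product is zero
   in both cases. *)
apply: filterS h20ae => w /(_ I) /= [] /eqP.
rewrite mulf_eq0 => /orP[|/eqP -> //].
by rewrite sqrf_eq0 normr_eq0 => /eqP ->; rewrite (ipC hip) (ip0l hip) expr0n.
Qed.

End LabelledSgd.

(** * Assembling the last-iterate bound for the prescribed step size *)

Theorem theorem1 (R : realType) (V : completeNormedModType R)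
  (ip : V -> V -> R)
  (d : measure_display) (Om : measurableType d) (P : probability Om R)
  (X : Om -> V) (Y : Om -> R)
  (d' : measure_display) (W : measurableType d') (Q : probability W R)
  (S : nat -> W -> Om)
  (theta_s : V) (r : R) (T : nat) :
  is_hilbert_ip ip ->
  separable_space V ->
  (* (X, Y) ~ rho : measurability (weak measurability of X) *)
  (forall u, measurable_fun setT (fun w => ip u (X w))) ->
  measurable_fun setT Y ->
  (* the covariance operator H = E[X (x) X] is well defined (E ||X||^2 < oo) *)
  P.-integrable setT (fun w => (`|X w| ^+ 2)%:E) ->
  (* noiseless model *)
  {ae P, forall w, ip theta_s (X w) = Y w} ->
  (* fourth moment condition E[||X||^2 X (x) X] <= r H in Loewner order *)
  0 <= r ->
  (forall v, (\int[P]_w ((`|X w| ^+ 2 * (ip v (X w)) ^+ 2)%:E)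
              <= r%:E * \int[P]_w (((ip v (X w)) ^+ 2)%:E))%E) ->
  (* i.i.d. samples from rho *)
  iid_seq Q P S ->
  (2 <= T)%N ->
  (\int[Q]_w risk P ip X Y
      (sgd ip X Y ((4 * r * ln (T%:R : R))^-1) (fun t => S t w) T)
   <= (3 * r * `|theta_s| ^+ 2 * ln (T%:R : R) / T%:R)%:E)%E.
Proof.
move=> hip hsep mX mY iX noiseless r0 m4 iidS T2.
rewrite (integral_risk_sgd hip hsep mX mY noiseless _ _ iidS).
set L := ln _; set g := (4 * r * L)^-1.
have [L0 c0 c1 hexp] := sgd_constant R T2; rewrite -/L in L0 c0 c1 hexp.
have T0 : (0 < T)%N by exact: leq_trans T2.
have T0R : 0 < T%:R :> R by rewrite ltr0n.
have N0 : 0 <= `|theta_s| ^+ 2 by exact: sqr_ge0.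
have [r0'|rn0] := eqVneq r 0.
  have e0 v : (\int[P]_w ((ip v (X w) ^+ 2)%:E) = 0)%E.
    by apply: (fourth_moment0 hip hsep mX); rewrite (le_trans (m4 v))// r0' mul0e.
  rewrite /excess; under eq_integral do rewrite e0.
  by rewrite integral0 mule0 lee_fin r0' mulr0 !mul0r.
have rp : 0 < r by rewrite lt_neqAle eq_sym rn0.
have g0 : 0 < g by rewrite invr_gt0 !mulr_gt0.
(* This product is the [c] of [sgd_constant]. *)
have gr : g * r = (4 * L)^-1.
  by rewrite /g; field; rewrite rn0 gt_eqF.
set e := excess ip P Q X g S theta_s.
pose f t := fine (e t).
have f0 t : 0 <= f t by rewrite fine_ge0// excess_ge0.
have eF : e T = (f T)%:E.
  rewrite fineK//.
  by have [] := err_norm_excess_fin hip hsep mX theta_s iX r0 m4 iidS (ltW g0) T.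
pose Sg := \sum_(0 <= t < T.+1) f t.
have Sg0 : 0 <= Sg by apply: sumr_ge0 => t _; exact: f0.
have sumle : g * (2 - (4 * L)^-1) * Sg <= `|theta_s| ^+ 2.
  rewrite -gr.
  exact: (excess_sum_le hip hsep mX theta_s iX r0 m4 iidS (ltW g0) T.+1).
have suffix s : (s <= T)%N ->
    (1 - (4 * L)^-1) * (\sum_(s <= t < T.+1) f t) <= (T - s).+1%:R * f s.
  move=> sT.
  (* The length [(T - s).+1] makes the sum end at [T] inclusive; the common factor [g] is then
     cancelled. *)
  have := excess_suffix_sum_le hip hsep mX theta_s iX r0 m4 iidS (ltW g0)
    s (T - s).+1.
  by rewrite addnS subnKC// gr -!mulrA ler_pM2l.
have last := last_iterate_le_average (ltW c0) f0 suffix T0.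
rewrite -/e eF -EFinM lee_fin -ler_pdivlMl ?invr_gt0// invrK.
apply: (le_trans last); rewrite -/Sg.
have T1R : 0 < T.+1%:R :> R by rewrite ltr0n.
(* The factor [2 - c] cancels against the one in [sumle], leaving [3 / 2 / g = 6 * r * L]; the 1/2
   in the risk halves this to 3. *)
apply: (@le_trans _ _ (3 / 2 * (2 - (4 * L)^-1) * (Sg / T.+1%:R))).
  by apply: ler_wpM2r hexp; apply: divr_ge0 => //; exact: ltW.
apply: (@le_trans _ _ (6 * r * L * `|theta_s| ^+ 2 / T.+1%:R)).
  rewrite mulrA ler_pM2r ?invr_gt0//.
  have -> : 3 / 2 * (2 - (4 * L)^-1) * Sg =
      6 * r * L * (g * (2 - (4 * L)^-1) * Sg).
    by rewrite /g; field; rewrite rn0 gt_eqF.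
  by rewrite ler_pM2l// !mulr_gt0.
have -> : 2 * (3 * r * `|theta_s| ^+ 2 * L / T%:R) =
    6 * r * L * `|theta_s| ^+ 2 / T%:R.
  by field; rewrite gt_eqF.
apply: ler_wpM2l; first by rewrite !mulr_ge0// ltW.
by rewrite lef_pV2 ?posrE// ler_nat.
Qed.
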